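(* Let $B$ be a finite set and $\gamma\subseteq B^2$ a binary relation such that for some $0,1\in B$ we have $(0,1),(0,0),(1,1)\in\gamma$ and $(1,0)\notin\gamma$. Let $\mathbf B=(B;\gamma)$. Then $\mathrm{CSP}(\mathbf B)$ is not constant-query testable (even with two-sided error).
   Context: $\mathrm{CSP}(\mathbf B)$: instances $(V,\mathcal C,w)$ with constraints $\langle(x,y),\gamma\rangle$, $x,y\in V$, and weights $w:V\to[0,1]$ summing to 1; an assignment $f:V\to B$ is satisfying if $(f(x),f(y))\in\gamma$ for all constraints. $\mathrm{dist}_{\mathcal I}(f)$ is the minimum total weight of variables where $f$ differs from a satisfying assignment; $f$ is $\epsilon$-far if $\mathrm{dist}_{\mathcal I}(f)>\epsilon$. An $\epsilon$-tester gets the instance and $\epsilon$ in full, queries values of $f$, accepts satisfying $f$ with probability $\ge 2/3$ and rejects $\epsilon$-far $f$ with probability $\ge2/3$. Constant-query testable means: for every $\epsilon\in(0,1)$ there is an $\epsilon$-tester whose number of queries is bounded by a function of $\epsilon$ alone, independent of the number $n=|V|$ of variables. *)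

(* Defs.v *)
From mathcomp Require Import all_boot.
From Stdlib Require Import Reals.

Set Implicit Arguments.
Unset Strict Implicit.
Unset Printing Implicit Defensive.

Definition rsum (n : nat) (P : pred 'I_n) (F : 'I_n -> R) : R :=
  \big[Rplus/0%R]_(x < n | P x) F x.

(* An instance of CSP(B) with B = (B; gamma) having a single binary relation:
   variables V = 'I_n, constraints <(x,y), gamma> given as a list of pairs,
   and weights w : V -> [0,1] summing to 1. *)
Record instance (n : nat) := Instance {
  cons : seq ('I_n * 'I_n);
  wt : 'I_n -> R;
  wt_ge0 : forall x, (0 <= wt x)%R;
  wt_le1 : forall x, (wt x <= 1)%R;
  wt_sum : rsum predT wt = 1%R
}.

Definition satisfying (B : finType) (gamma : rel B) (n : nat) (I : instance n)
  (f : 'I_n -> B) : Prop :=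
  forall c, c \in cons I -> gamma (f c.1) (f c.2).

Definition diff_weight (B : finType) (n : nat) (I : instance n) (f g : 'I_n -> B) : R :=
  rsum (fun x => f x != g x) (wt I).

(* f is eps-far: dist_I(f) = min over satisfying g of diff_weight > eps,
   i.e. every satisfying assignment differs from f on weight > eps. *)
Definition far (B : finType) (gamma : rel B) (n : nat) (I : instance n)
  (eps : R) (f : 'I_n -> B) : Prop :=
  forall g, satisfying gamma I g -> (diff_weight I f g > eps)%R.

(* Deterministic adaptive query algorithms: decision trees whose internal nodes
   query the value of f at a variable and branch on the answer. *)
Inductive qtree (B : Type) (n : nat) : Type :=
| Leaf : bool -> qtree B n
| Query : 'I_n -> (B -> qtree B n) -> qtree B n.

Fixpoint depth (B : finType) (n : nat) (t : qtree B n) : nat :=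
  match t with
  | Leaf _ => 0
  | Query _ k => (\max_(b : B) depth (k b)).+1
  end.

Fixpoint run (B : Type) (n : nat) (t : qtree B n) (f : 'I_n -> B) : bool :=
  match t with
  | Leaf a => a
  | Query x k => run (k (f x)) f
  end.

(* A randomized query algorithm = a finitely supported probability
   distribution over deterministic decision trees. *)
Definition rtester (B : Type) (n : nat) := seq (R * qtree B n).

Definition is_distribution (B : Type) (n : nat) (D : rtester B n) : Prop :=
  (forall pt, List.In pt D -> (0 <= pt.1)%R) /\
  foldr Rplus 0%R (map fst D) = 1%R.

Definition max_queries (B : finType) (n : nat) (D : rtester B n) (q : nat) : Prop :=
  forall pt, List.In pt D -> depth pt.2 <= q.

Definition accept_prob (B : Type) (n : nat) (D : rtester B n) (f : 'I_n -> B) : R :=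
  foldr Rplus 0%R (map (fun pt => if run pt.2 f then pt.1 else 0%R) D).

Definition is_tester (B : finType) (gamma : rel B) (n : nat) (I : instance n)
  (eps : R) (D : rtester B n) : Prop :=
  is_distribution D /\
  forall f : 'I_n -> B,
    (satisfying gamma I f -> (accept_prob D f >= 2/3)%R) /\
    (far gamma I eps f -> (1 - accept_prob D f >= 2/3)%R).

Definition const_query_testable (B : finType) (gamma : rel B) : Prop :=
  forall eps : R, (0 < eps < 1)%R ->
    exists q : nat, forall (n : nat) (I : instance n),
      exists D : rtester B n, max_queries D q /\ is_tester gamma I eps D.

(* Main.v *)
Require Import Defs.
From HB Require Import structures.
From mathcomp Require Import all_boot.
From Stdlib Require Import Reals Lra.
(* [Reals] redefines [^] in [nat_scope]. *)
Import ssrnat.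

(** The constraint graph is a bipartite hypercube: both sides are two copies of
    the cube [{0,1}^r], and every [x] on the left is joined to [flip i x] on the
    right, for each direction [i].  For a fixed [i], the edges of direction [i]
    from [x_i = 0] to [y_i = 1] form a matching that is induced: no edge of
    another direction joins these two vertex sets.  Give [b0] to the remaining
    left vertices and [b1] to the remaining right vertices, so that only the
    matching matters, and put random values on it: equal values along each
    matching edge give a satisfying assignment, opposite values a far one.
    The two cases look the same to any set of queries that does not contain
    both ends of an edge of direction [i].  A tree of depth [q] queries fewer
    than [2^q] vertices on inputs with values in [{b0, b1}], hence is useful for
    at most [4^q] directions, and [r = 4^(q+1)] directions are too many. *)

Set Implicit Arguments.
Unset Strict Implicit.
Unset Printing Implicit Defensive.

HB.instance Definition _ := Monoid.isComLaw.Build R 0%R Rplus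
  (fun x y z => esym (Rplus_assoc x y z)) Rplus_comm Rplus_0_l.

Lemma Rsum_const (T : finType) (P : pred T) (c : R) :
  \big[Rplus/0%R]_(a | P a) c = (INR #|P| * c)%R.
Proof.
rewrite big_const; elim: #|_| => [|n IHn]; first by rewrite /= Rmult_0_l.
by rewrite iterS IHn S_INR; lra.
Qed.

Lemma Rsum_le (T : finType) (F G : T -> R) :
  (forall a, (F a <= G a)%R) ->
  (\big[Rplus/0%R]_a F a <= \big[Rplus/0%R]_a G a)%R.
Proof.
move=> leFG; apply: (big_ind2 Rle) => //; first exact: Rle_refl.
by move=> *; apply: Rplus_le_compat.
Qed.

Lemma leq_INR (m n : nat) : m <= n -> (INR m <= INR n)%R.
Proof. by move/leP; exact: le_INR. Qed.

(** * Decision trees and averaged acceptance probabilities *)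

Section QueryTrees.

Variables (B : finType) (n : nat).

(** Only answers [b0] and [b1] are followed, so the size bound is independent of [#|B|]. *)
Fixpoint queries (b0 b1 : B) (t : qtree B n) : seq 'I_n :=
  match t with
  | Leaf _ => [::]
  | Query x k => x :: queries b0 b1 (k b0) ++ queries b0 b1 (k b1)
  end.

Lemma size_queries b0 b1 (t : qtree B n) :
  size (queries b0 b1 t) < 2 ^ depth t.
Proof.
elim: t => [//|x k IHk] /=.
have le b : 2 ^ depth (k b) <= 2 ^ \max_b depth (k b).
  by rewrite leq_exp2l //; apply: leq_bigmax.
rewrite expnS mul2n -addnn size_cat -addSn -addnS.
by apply: leq_add; apply: leq_trans (IHk _) (le _).
Qed.

Lemma eq_run b0 b1 (t : qtree B n) (f g : 'I_n -> B) :
  (forall x, f x = b0 \/ f x = b1) ->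
  {in queries b0 b1 t, f =1 g} -> run t f = run t g.
Proof.
move=> fP; elim: t => [//|x k IHk] /= eq_fg.
rewrite -eq_fg ?mem_head //; apply: IHk => y yk; apply: eq_fg.
by case: (fP x) yk => -> yk; rewrite inE mem_cat yk ?orbT.
Qed.

(** Averaging over [a] reduces a randomized tester to its trees: the error [K] of each tree is
    weighted by its probability. *)
Lemma sum_accept_prob_le (A : finType) (F G : A -> 'I_n -> B) (K : nat)
    (D : rtester B n) :
  (forall pt, List.In pt D -> (0 <= pt.1)%R) ->
  (forall pt, List.In pt D ->
    #|[pred a | run pt.2 (F a)]| <= #|[pred a | run pt.2 (G a)]| + K) ->
  (\big[Rplus/0%R]_a accept_prob D (F a) <=
   \big[Rplus/0%R]_a accept_prob D (G a)
   + INR K * foldr Rplus 0%R (map fst D))%R.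
Proof.
have sumE (H : A -> 'I_n -> B) pt D' :
  \big[Rplus/0%R]_a accept_prob (pt :: D') (H a) =
  (INR #|[pred a | run pt.2 (H a)]| * pt.1
   + \big[Rplus/0%R]_a accept_prob D' (H a))%R.
  by rewrite /accept_prob /= big_split -big_mkcond /= Rsum_const.
elim: D => [|pt D IHD] p_ge0 leFG.
  by rewrite /= /accept_prob /= !Rsum_const; lra.
rewrite !sumE /=.
have {}IHD := IHD (fun pt' H => p_ge0 pt' (or_intror H))
                  (fun pt' H => leFG pt' (or_intror H)).
have := leq_INR (leFG pt (or_introl (erefl pt))).
rewrite plus_INR => /(Rmult_le_compat_r _ _ _ (p_ge0 pt (or_introl (erefl pt)))).
by lra.
Qed.

End QueryTrees.

(** * The hypercube instance and its hard inputs *)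

Section Cube.

Variable r : nat.

Notation point := {ffun 'I_r -> bool}.

Definition flip (i : 'I_r) (x : point) : point := [ffun k => (k == i) (+) x k].

Lemma flipK i : involutive (flip i).
Proof. by move=> x; apply/ffunP=> k; rewrite !ffunE addKb. Qed.

Lemma flip_dir_inj x i j : flip i x = flip j x -> i = j.
Proof. by move/ffunP/(_ i); rewrite !ffunE eqxx => /addIb/esym/eqP. Qed.

Lemma card_half_cube i : #|[pred x : point | ~~ x i]|.*2 = #|{: point}|.
Proof.
rewrite -(cardC [pred x : point | ~~ x i]) -addnn; congr (_ + _).
rewrite -(card_image (inv_inj (flipK i))); apply: eq_card => x.
rewrite -[x in LHS](flipK i) mem_image; last exact: inv_inj (flipK i).
by rewrite !inE ffunE eqxx.
Qed.

(* (right side?, copy, point) *)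
Definition vertex := (bool * bool * point)%type.

Notation nvert := #|{: vertex}|.

Definition edges : seq ('I_nvert * 'I_nvert) :=
  [seq (enum_rank (false, e.1.1, e.2), enum_rank (true, e.1.1, flip e.1.2 e.2))
  | e <- enum {: (bool * 'I_r) * point}].

Lemma nvert_gt0 : 0 < nvert.
Proof. by apply/card_gt0P; exists (false, false, [ffun => false]). Qed.

Lemma INR_nvert_gt0 : (0 < INR nvert)%R.
Proof. by apply/lt_0_INR/ltP/nvert_gt0. Qed.

Lemma cube_wt_ge0 (x : 'I_nvert) : (0 <= / INR nvert)%R.
Proof. by apply/Rlt_le/Rinv_0_lt_compat/INR_nvert_gt0. Qed.

Lemma cube_wt_le1 (x : 'I_nvert) : (/ INR nvert <= 1)%R.
Proof.
rewrite -Rinv_1; apply: Rinv_le_contravar; first lra.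
exact: (leq_INR nvert_gt0).
Qed.

Lemma cube_wt_sum : rsum predT (fun _ : 'I_nvert => (/ INR nvert)%R) = 1%R.
Proof.
rewrite /rsum Rsum_const [#|predT|]card_ord Rinv_r //.
by apply/Rgt_not_eq/INR_nvert_gt0.
Qed.

Definition cube_instance : instance nvert :=
  Instance edges cube_wt_ge0 cube_wt_le1 cube_wt_sum.

Variables (B : finType) (gamma : rel B) (b0 b1 : B).

(* The two copies [c] of a vertex carry opposite values, so that exactly half of
   the matching is violated when [t = true], whatever [s] is. *)
Definition assign (t : bool) (a : 'I_r * {ffun point -> bool}) (u : 'I_nvert) : B :=
  let: (i, s) := a in let: (right_side, c, x) := enum_val u in
  if right_side then
    if x i then (if s (flip i x) (+) c (+) t then b1 else b0) else b1
  else if x i then b0 else (if s x (+) c then b1 else b0).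

Lemma assign_b01 t a u : assign t a u = b0 \/ assign t a u = b1.
Proof.
rewrite /assign; case: a => i s; case: (enum_val u) => -[[] c] x;
  by repeat case: ifP => _; auto.
Qed.

(** An edge off the matching has [b0] on its left end or [b1] on its right end, which [gamma] allows
    whatever the other end is. *)
Lemma assign_satisfying a :
  gamma b0 b1 -> gamma b0 b0 -> gamma b1 b1 ->
  satisfying gamma cube_instance (assign false a).
Proof.
move=> g01 g00 g11 c /mapP[[[d j] x] _ ->] /=; case: a => i s.
rewrite /assign !enum_rankK ffunE; case xi: (x i).
  by repeat case: ifP => _.
rewrite addbF; case: eqP => [->|_] /=; last by case: ifP.
by rewrite flipK addbF; case: ifP.
Qed.

(** The violated matching edges are disjoint, one for each [x] with [x i = false]. A satisfying [g]
    differs from [f] at an end of each, hence on at least 1/8 of the vertices. *)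
Lemma assign_far a :
  ~~ gamma b1 b0 -> far gamma cube_instance (/ 10)%R (assign true a).
Proof.
case: a => i s g10 g gsat.
set f := assign true _.
(* In copy [~~ s x] the left end has value [b1] and the right end [b0]. *)
pose lv (x : point) : 'I_nvert := enum_rank (false, ~~ s x, x).
pose rv (x : point) : 'I_nvert := enum_rank (true, ~~ s x, flip i x).
pose h (x : point) := if f (lv x) != g (lv x) then lv x else rv x.
have h_inj : injective h.
  by move=> x y; rewrite /h; do 2!case: ifP => _;
     move=> /enum_rank_inj [] // => _ /(inv_inj (flipK i)).
have hP (x : point) : ~~ x i -> f (h x) != g (h x).
  move=> xi; rewrite /h; case: ifPn => //; rewrite negbK => /eqP fgl.
  apply: contraNneq g10 => fgr.
  have -> : b1 = f (lv x).
    by rewrite /f /assign enum_rankK (negbTE xi) addbN addbb.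
  have -> : b0 = f (rv x).
    rewrite /f /assign enum_rankK ffunE eqxx (negbTE xi) /= flipK.
    by rewrite addbN addbb.
  rewrite fgl fgr; apply: (gsat (lv x, rv x)); apply/mapP.
  by exists ((~~ s x, i), x); rewrite ?mem_enum.
have le_card : #|[pred x : point | ~~ x i]| <= #|[pred u | f u != g u]|.
  rewrite -(card_image h_inj); apply/subset_leq_card/subsetP=> u /imageP[x].
  by rewrite !inE => xi ->; apply: hP.
rewrite /diff_weight /rsum Rsum_const.
have NE : INR nvert = (8 * INR #|[pred x : point | ~~ x i]|)%R.
  rewrite !card_prod card_bool -(card_half_cube i) -mul2n mulnA mult_INR.
  by congr Rmult; rewrite /=; lra.
have N0 := INR_nvert_gt0.
apply: Rlt_gt; apply: (Rmult_lt_reg_r (INR nvert)) => //.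
rewrite Rmult_assoc Rinv_l ?Rmult_1_r; last lra.
by apply: Rlt_le_trans (leq_INR le_card); lra.
Qed.

Definition exposed (Q : seq 'I_nvert) : pred 'I_r := fun i =>
  [exists x, [exists c, [exists d,
    (enum_rank (false, c, x) \in Q) && (enum_rank (true, d, flip i x) \in Q)]]].

(** A pair of queried vertices determines at most one direction, by [flip_dir_inj]. *)
Lemma card_exposed (Q : seq 'I_nvert) : #|exposed Q| <= size Q * size Q.
Proof.
pose dir (u v : 'I_nvert) := [pick i | (enum_val v).2 == flip i (enum_val u).2].
rewrite cardE -(size_map Some) -(size_allpairs dir).
apply: uniq_leq_size => [|o /mapP[i]].
  by rewrite (map_inj_uniq Some_inj) enum_uniq.
rewrite mem_enum => /existsP[x /existsP[c /existsP[d /andP[uQ vQ]]]] ->.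
apply/allpairsP; exists (enum_rank (false, c, x), enum_rank (true, d, flip i x)).
split=> //=; rewrite /dir !enum_rankK /=; case: pickP => [j /eqP|/(_ i)].
  by move/flip_dir_inj ->.
by rewrite eqxx.
Qed.

(* Flipping [s] below the queried right vertices turns the "yes" answers into
   the "no" answers, provided that no matching edge is queried at both ends. *)
Lemma card_run_unexposed (t : qtree B nvert) i :
  ~~ exposed (queries b0 b1 t) i ->
  #|[pred s | run t (assign false (i, s))]| <=
  #|[pred s | run t (assign true (i, s))]|.
Proof.
set Q := queries _ _ _ => unexp.
pose hit (x : point) := [exists c, enum_rank (true, c, flip i x) \in Q].
pose phi (s : {ffun point -> bool}) := [ffun x => hit x (+) s x].
have phiK : involutive phi by move=> s; apply/ffunP=> x; rewrite !ffunE addKb.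
rewrite -(card_image (inv_inj phiK)).
apply/subset_leq_card/subsetP=> _ /imageP[s + ->]; rewrite !inE => sP.
apply: etrans sP; apply: (eq_run (b0 := b0) (b1 := b1)); first exact: assign_b01.
move=> u uQ; rewrite /assign.
case uE: (enum_val u) => [[[] c] x]; case: ifP => // xi;
  move: uQ; rewrite -(enum_valK u) uE !ffunE => uQ.
  have -> : hit (flip i x) by apply/existsP; exists c; rewrite flipK.
  by case: (s _); case: c uE uQ.
suff /negbTE -> : ~~ hit x by [].
apply: contra unexp => /existsP[d dQ]; apply/existsP; exists x.
by apply/existsP; exists c; apply/existsP; exists d; rewrite uQ.
Qed.

(** Unexposed directions contribute no error; each of the at most [4 ^ q] exposed ones contributes
    at most the number of choices of [s]. *)
Lemma card_run_assign (t : qtree B nvert) q :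
  depth t <= q ->
  #|[pred a | run t (assign false a)]| <=
  #|[pred a | run t (assign true a)]| + 4 ^ q * #|{ffun point -> bool}|.
Proof.
move=> tq; set Q := queries b0 b1 t; set S := #|{ffun point -> bool}|.
have cardE b : #|[pred a | run t (assign b a)]| =
    \sum_i #|[pred s | run t (assign b (i, s))]|.
  under [RHS]eq_bigr do rewrite -sum1_card.
  by rewrite pair_big_dep -sum1_card; apply: eq_bigl => -[i s].
have QS : #|exposed Q| * S <= 4 ^ q * S.
  rewrite leq_mul2r; apply/orP; right; apply: leq_trans (card_exposed Q) _.
  have sQ : size Q <= 2 ^ q.
    by apply: leq_trans (ltnW (size_queries b0 b1 t)) _; rewrite leq_exp2l.
  by rewrite (expnMn 2 2); apply: leq_mul.
apply: leq_trans (leq_add (leqnn _) QS); rewrite !cardE.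
rewrite -sum_nat_const [X in _ + X]big_mkcond -big_split /=; apply: leq_sum => i _.
case: ifPn => [_|unexp]; last by rewrite addn0 card_run_unexposed.
by apply: leq_trans (leq_addl _ _); apply: max_card.
Qed.

End Cube.

Theorem mainTheorem10 (B : finType) (gamma : rel B) (b0 b1 : B) :
  gamma b0 b1 -> gamma b0 b0 -> gamma b1 b1 -> ~~ gamma b1 b0 ->
  ~ const_query_testable gamma.
Proof.
move=> g01 g00 g11 g10 /(_ (/ 10)%R) [|q testable]; first lra.
have [D [Dq [[p_ge0 p_sum] DP]]] := testable _ (cube_instance (4 ^ q.+1)).
set r := 4 ^ q.+1 in D Dq p_ge0 p_sum DP.
pose S := #|{ffun {ffun 'I_r -> bool} -> bool}|.
have := sum_accept_prob_le p_ge0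
  (fun pt ptD => card_run_assign b0 b1 (Dq pt ptD)).
rewrite p_sum Rmult_1_r -/S.
have yes a : (2 / 3 <= accept_prob D (assign b0 b1 false a))%R.
  by apply/Rge_le/(DP _).1/assign_satisfying.
have no a : (accept_prob D (assign b0 b1 true a) <= 1 / 3)%R.
  by have := (DP _).2 (assign_far a g10); lra.
have := Rsum_le yes; have := Rsum_le no; rewrite !Rsum_const.
(* With [K = 4 ^ q * S] there are [4K] inputs, so the bounds give [8K/3 <= 4K/3 + K], which is
   absurd for [K > 0]. *)
have -> : #|{: 'I_r * {ffun {ffun 'I_r -> bool} -> bool}}| = 4 * (4 ^ q * S).
  by rewrite card_prod card_ord mulnA -expnS.
have : (0 < INR (4 ^ q * S))%R.
  apply/lt_0_INR/ltP; rewrite muln_gt0 expn_gt0 /=.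
  by apply/card_gt0P; exists [ffun => false].
rewrite (mult_INR 4) [INR 4]/=; set K := INR _; lra.
Qed.
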